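(* Let $A=\beta^2\Delta_h+\epsilon^2\Delta_h^2\in\mathbb{R}^{N_x\times N_x}$, where $\Delta_h$ is the one-dimensional discrete Neumann Laplacian with eigenvalues $\lambda_p$, $p=1,\dots,N_x$, and let $A=PDP^{-1}$ with $D$ diagonal. Let $T>0$, let $\mathbf{u}$ solve $\dot{\mathbf{u}}(t)+A\mathbf{u}(t)=0$ on $(0,T]$, $\mathbf{u}(0)=\mathbf{u}_0$, and let $\mathbf{u}^k$ be the $k$-th iterate ($k\ge1$, from an initial guess $\mathbf{u}^0$) of the semi-discrete PinT algorithm $$\dot{\mathbf{u}}^k(t)+A\mathbf{u}^k(t)=0,\qquad \mathbf{u}^k(0)=\alpha\mathbf{u}^k(T)-\alpha\mathbf{u}^{k-1}(T)+\mathbf{u}_0,$$ with $|\alpha|<1/2$. Let $\mathbf{e}^k(t)=\mathbf{u}^k(t)-\mathbf{u}(t)$. Then $$\| P^{-1}\mathbf{e}^k \|_{L^{\infty}(0, T;L^{\infty}(\Omega))}\leq \rho^k \| P^{-1}\mathbf{e}^0\|_{L^{\infty}(0, T;L^{\infty}(\Omega))},$$ where, with $z=\lambda_pT\le0$, the factor denoted $\rho^k$ is $$\rho^k=\begin{cases} e^{-g(z^* )}\left(\dfrac{|\alpha|e^{-g(z^* )}}{1-|\alpha|e^{-g(z^* )}}\right)^k, & z>-\dfrac{\beta^2T}{\epsilon^2},\\[2ex] \left(\dfrac{|\alpha|}{1-|\alpha|}\right)^k, & z\le-\dfrac{\beta^2T}{\epsilon^2},\end{cases}$$ with $g(z)=\frac{\epsilon^2}{T}z^2+\beta^2z$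 and $z^*=-\frac{\beta^2T}{2\epsilon^2}$. The case distinction is by eigenmode: for each of the two ranges of $z$, the estimate with the corresponding factor holds with $P^{-1}\mathbf{e}^k$ and $P^{-1}\mathbf{e}^0$ restricted to the coordinates $p$ for which $z=\lambda_pT$ lies in that range.
   Context: $\Delta_h\in\mathbb{R}^{N_x\times N_x}$ is the central finite difference Laplacian on an interval $\Omega$ with $N_x$ equidistant grid points, mesh size $h$, and homogeneous Neumann conditions: $\Delta_h=h^{-2}B$, where $B$ is tridiagonal with all diagonal entries $-2$, all sub- and superdiagonal entries $1$, except that $B_{1,2}=2$ and $B_{N_x,N_x-1}=2$. Its eigenvalues are $\lambda_p=\frac{2}{h^2}\{\cos(\frac{(p-1)\pi}{N_x-1})-1\}$, $p=1,\dots,N_x$. The $p$-th diagonal entry of $D$ is $\beta^2\lambda_p+\epsilon^2\lambda_p^2$, and the $p$-th column of $P$ is a corresponding eigenvector (common to $\Delta_h$ and $A$). Here $\beta\in[-1/\sqrt3,1/\sqrt3]$, $0<\epsilon\ll1$, and $\alpha\in(0,1)$ is the free parameter of the algorithm. For $\mathbf{v}:[0,T]\to\mathbb{R}^{N_x}$, $\|\mathbf{v}\|_{L^\infty(0,T;L^\infty(\Omega))}=\max_{t\in[0,T]}\|\mathbf{v}(t)\|_\infty$, with $\|\cdot\|_\infty$ the maximum norm.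
   Formalization: The first estimate (z > -β²T/ε²) is stated under the added assumption |α|e^{-g(z* )} < 1; otherwise its factor has a zero or negative denominator and the bound fails, e.g. at k = 1 for T = 1, β² = 1/3, ε = 0.1, α = 0.4. *)

(* Defs.v *)
From HB Require Import structures.
From mathcomp Require Import all_boot all_order all_algebra.
From mathcomp Require Import all_classical all_reals all_analysis.

Set Implicit Arguments.
Unset Strict Implicit.
Unset Printing Implicit Defensive.

Import Order.TTheory GRing.Theory Num.Theory.
Import numFieldNormedType.Exports.

Local Open Scope classical_set_scope.
Local Open Scope ring_scope.

(* Grid indices run over 'I_Nx, i.e. the p-th object, p = 1, ..., Nx, has
   index p - 1 here. *)

Definition neumann_stencil (R : realType) (Nx : nat) : 'M[R]_Nx :=
  \matrix_(i, j)
    if i == j then - 2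
    else if j == i.+1 :> nat then (if i == 0 :> nat then 2 else 1)
    else if i == j.+1 :> nat then (if i == Nx.-1 :> nat then 2 else 1)
    else 0.

Definition laplacian (R : realType) (Nx : nat) (h : R) : 'M[R]_Nx :=
  h ^- 2 *: neumann_stencil R Nx.

Definition lambda (R : realType) (Nx : nat) (h : R) (p : 'I_Nx) : R :=
  2 / h ^+ 2 * (cos (p%:R * pi / Nx.-1%:R) - 1).

Definition opA (R : realType) (Nx : nat) (h beta eps : R) : 'M[R]_Nx :=
  beta ^+ 2 *: laplacian Nx h
  + eps ^+ 2 *: (laplacian Nx h *m laplacian Nx h).

Definition opD (R : realType) (Nx : nat) (h beta eps : R) : 'M[R]_Nx :=
  diag_mx (\row_p (beta ^+ 2 * lambda h p + eps ^+ 2 * lambda h p ^+ 2)).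

(* At t = T the derivative is the left derivative, since u is only relevant on
   [0, T]; no differentiability is required at t = 0. *)
Definition solves_on (R : realType) (Nx : nat) (A : 'M[R]_Nx) (T : R)
    (u : R -> 'cV[R]_Nx) : Prop :=
  [/\ {within `[0, T], continuous u},
      (forall t : R, 0 < t < T -> is_derive t (1 : R) u (- (A *m u t)))
    & (fun t : R => (t - T)^-1 *: (u t - u T)) @ T^'- --> - (A *m u T)].

Definition pint_iterates (R : realType) (Nx : nat) (A : 'M[R]_Nx) (T alpha : R)
    (u0 : 'cV[R]_Nx) (uk : nat -> R -> 'cV[R]_Nx) : Prop :=
  forall k : nat, (1 <= k)%N ->
    solves_on A T (uk k) /\
    uk k 0 = alpha *: uk k T - alpha *: uk k.-1 T + u0.

Definition restr (R : realType) (Nx : nat) (J : pred 'I_Nx) (v : 'cV[R]_Nx) :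
    'cV[R]_Nx :=
  \col_p (if J p then v p 0 else 0).

(* The norm `|_| on 'cV[R]_Nx is the maximum norm; the supremum is a maximum
   for v continuous on [0, T]. *)
Definition normLinf (R : realType) (Nx : nat) (T : R) (v : R -> 'cV[R]_Nx) : R :=
  sup [set `|v t| | t in `[0, T]].

Definition g (R : realType) (T beta eps z : R) : R :=
  eps ^+ 2 / T * z ^+ 2 + beta ^+ 2 * z.

Definition zstar (R : realType) (T beta eps : R) : R :=
  - (beta ^+ 2 * T / (2 * eps ^+ 2)).

Definition zcrit (R : realType) (T beta eps : R) : R :=
  - (beta ^+ 2 * T / eps ^+ 2).

(* Main.v *)
Require Import Defs.
From HB Require Import structures.
From mathcomp Require Import all_boot all_order all_algebra.
From mathcomp Require Import all_classical all_reals all_analysis.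
From mathcomp Require Import ring lra.

(** In the coordinates of [P] the error splits into scalar modes. Write $d_p$
    for the eigenvalue of the operator on the mode [p]. Since the iterate and the
    exact solution solve the same linear equation, the mode $w^k$ of the error
    satisfies $w^k(t) = e^{-d_p t} w^k(0)$ for $k \ge 1$ ([solves_on_mode]), and
    the initial condition of the algorithm becomes
    $w^k(0) = \alpha w^k(T) - \alpha w^{k-1}(T)$. With $q = e^{-d_p T}$ this
    gives $(1 - \alpha q) w^k(0) = - \alpha w^{k-1}(T)$, so that
    $|w^k(T)| \le \frac{|\alpha| q}{1 - |\alpha| q} |w^{k-1}(T)|$.

    Let $Q \ge 1$ bound $q$, with $|\alpha| Q < 1$. The factor increases with
    $q$, so $Q$ may replace $q$ in it, and iterating gives
    $|w^k(t)| \le Q (\frac{|\alpha| Q}{1 - |\alpha| Q})^k |w^0(T)|$, where the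
    first $Q$ bounds the growth of the mode over [0, t]
    ([mode_iterates_bound]). The initial guess is an arbitrary continuous
    function; it enters through its value at [T] only.

    It remains to choose $Q$. One has $d_p T = g(z)$ with $z = \lambda_p T$
    ([gE]). The parabola $g$ is minimal at $z_\ast$, [zstar], with
    $g(z_\ast) \le g(0) = 0$, so $Q = e^{-g(z_\ast)} \ge 1$ works for every
    mode. To the left of its smaller zero $-\beta^2 T / \epsilon^2$ the parabola is nonnegative, so
    $Q = 1$ works there. As $Q$ does not depend on the mode within either range, the scalar
    estimates pass to the maximum norm. *)

Set Implicit Arguments.
Unset Strict Implicit.
Unset Printing Implicit Defensive.

Import Order.TTheory GRing.Theory Num.Theory.
Import numFieldNormedType.Exports.

Local Open Scope classical_set_scope.
Local Open Scope ring_scope.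

(** * The maximum norm of vectors and of vector-valued functions *)

Lemma ler_norm_coord (R : realType) (n : nat) (x : 'cV[R]_n) (i : 'I_n) :
  `|x i 0| <= `|x|.
Proof.
rewrite [leRHS]/Num.Def.normr/= mx_normrE.
exact: (le_bigmax _ (fun ij : 'I_n * 'I_1 => `|x ij.1 ij.2|) (i, 0)).
Qed.

Lemma cV_norm_le (R : realType) (n : nat) (x : 'cV[R]_n) (B : R) :
  0 <= B -> (forall i, `|x i 0| <= B) -> `|x| <= B.
Proof.
move=> B0 xB; rewrite [leLHS]/Num.Def.normr/= mx_normrE.
rewrite bigmax_le//= => -[i j] _.
by rewrite (ord1 j); exact: xB.
Qed.

Lemma normLinf_le (R : realType) (n : nat) (T B : R) (v : R -> 'cV[R]_n) :
  0 <= T -> 0 <= B -> (forall t i, t \in `[0, T] -> `|v t i 0| <= B) ->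
  normLinf T v <= B.
Proof.
move=> T0 B0 vB; apply: ge_sup.
  by exists `|v 0|, 0 => //=; rewrite in_itv/= lexx T0.
by move=> _ [t tT <-]; apply: cV_norm_le => // i; exact: vB.
Qed.

Lemma continuous_within_bounded (R : realType) (T : R) (f : R -> R) :
  0 <= T -> {within `[0, T], continuous f} ->
  exists C, forall t, t \in `[0, T] -> `|f t| <= C.
Proof.
move=> T0 cf.
have [a _ fa] := EVT_max T0 cf; have [b _ fb] := EVT_min T0 cf.
exists (`|f a| + `|f b|) => t tT.
have := ler_norm (- f b); rewrite normrN.
move: (fa t tT) (fb t tT) (ler_norm (f a)) (normr_ge0 (f a)) (normr_ge0 (f b)).
by move=> *; rewrite ler_norml; apply/andP; split; lra.
Qed.

(** [sup] is only an upper bound of sets that are bounded above, whence the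
    continuity hypothesis, from which boundedness on [0, T] follows. *)
Lemma coord_le_normLinf (R : realType) (n : nat) (T : R) (v : R -> 'cV[R]_n) :
  0 <= T -> (forall i, {within `[0, T], continuous (fun t => v t i 0)}) ->
  forall t i, t \in `[0, T] -> `|v t i 0| <= normLinf T v.
Proof.
move=> T0 cv t i tT; apply: le_trans (ler_norm_coord _ _) _.
have /choice[C vC] i' := continuous_within_bounded T0 (cv i').
apply: ub_le_sup; last by exists t.
have C0 j : 0 <= C j by apply: le_trans (vC j t tT).
exists (\sum_j C j) => _ [s sT <-]; apply: cV_norm_le; first exact: sumr_ge0.
move=> j; apply: le_trans (vC j s sT) _.
by rewrite (bigD1 j)//= lerDl sumr_ge0.
Qed.

(** * Coordinates of [M *m v t] *)

Lemma mulmx_coord_continuous (R : realType) (m n : nat) (M : 'M[R]_(m, n)) p :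
  continuous (fun x : 'cV[R]_n => (M *m x) p 0).
Proof.
have -> : (fun x : 'cV[R]_n => (M *m x) p 0)
    = \sum_j (fun x : 'cV[R]_n => M p j * x j 0).
  by apply/funext => x; rewrite mxE fct_sumE.
elim/big_ind : _ => [x|f1 f2 cf1 cf2 x|j _ x].
- exact: (@cst_continuous 'cV[R]_n R 0).
- exact: cvgD (cf1 x) (cf2 x).
- apply: continuousM; [exact: cst_continuous | exact: coord_continuous].
Qed.

Lemma within_continuous_mulmx_coord (R : realType) (m n : nat)
    (M : 'M[R]_(m, n)) p (A : set R) (v : R -> 'cV[R]_n) :
  {within A, continuous v} -> {within A, continuous (fun t => (M *m v t) p 0)}.
Proof.
move=> cv t; apply: (@continuous_comp (subspace A) _ _ v
  (fun x => (M *m x) p 0) t (cv t)).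
exact: mulmx_coord_continuous.
Qed.

Lemma is_derive_mulmx_coord (R : realType) (m n : nat) (M : 'M[R]_(m, n)) p
    (t : R) (v : R -> 'cV[R]_n) (dv : 'cV[R]_n) :
  is_derive t 1 v dv -> is_derive t 1 (fun s => (M *m v s) p 0) ((M *m dv) p 0).
Proof.
case=> vt <-.
have dc j : is_derive t 1 (fun s => v s j 0) (('D_1 v t) j 0).
  split; first exact: (derivable_mxP v t 1).1.
  by rewrite (derive_mx vt) mxE.
rewrite mxE.
have -> : (fun s => (M *m v s) p 0) = \sum_j (M p j *: (fun s => v s j 0)).
  by apply/funext => s; rewrite mxE fct_sumE.
exact: is_derive_sum.
Qed.

(** * Exact solution and contraction of a single mode *)

(** The function $e^{d t} f(t)$ has zero derivative, so the mean value theorem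
    on [0, t] makes it constant. *)
Lemma linear_ode_unique (R : realType) (d T : R) (f : R -> R) :
  {within `[0, T], continuous f} ->
  (forall t, 0 < t < T -> is_derive t (1 : R) f (- (d * f t))) ->
  forall t, t \in `[0, T] -> f t = expR (- (d * t)) * f 0.
Proof.
move=> cf df t /[!in_itv]/= /andP[t0 tT].
pose F s := expR (d * s) * f s.
have dF s : s \in `]0, t[%R -> is_derive s (1 : R) F 0.
  rewrite in_itv/= => /andP[s0 st].
  have dfs : is_derive s (1 : R) f (- (d * f s)) by apply: df; lra.
  have dl : is_derive s (1 : R) (fun x : R => d * x) d.
    by apply: (is_derive_eq (is_deriveZ d (is_derive_id s 1))); exact: mulr1.
  have de : is_derive s (1 : R) (expR \o (fun x => d * x)) (expR (d * s) * d).
    exact: is_derive1_comp.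
  apply: (is_derive_eq (is_deriveM de dfs)) => /=.
  by rewrite /GRing.scale/=; ring.
have cF : {within `[0, t], continuous F}.
  have ct : {within `[0, t], continuous f}.
    apply: continuous_subspaceW cf => x /=; rewrite !in_itv/= => /andP[-> xt].
    exact: le_trans tT.
  have ce : {within `[0, t], continuous (expR \o ( *%R d))}.
    apply: continuous_subspaceT => y.
    apply: continuous_comp; [exact: mulrl_continuous | exact: continuous_expR].
  by move=> x; exact: (continuousM (ce x) (ct x)).
have [c _] := MVT_segment t0 dF cF.
rewrite mul0r => /eqP; rewrite subr_eq0 /F mulr0 expR0 mul1r => /eqP <-.
by rewrite mulrA -expRD addNr expR0 mul1r.
Qed.

(** Solving the end-point relation $x = \alpha q x - \alpha y$ costs the factor
    $|\alpha| / (1 - |\alpha| q)$; [c] stands for the growth of the mode up to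
    an arbitrary time. *)
Lemma shooting_step (R : realType) (alpha q c Q x y : R) :
  0 <= q <= Q -> 0 <= c <= Q -> `|alpha| * Q < 1 ->
  x = alpha * (q * x) - alpha * y ->
  `|c * x| <= `|alpha| * Q / (1 - `|alpha| * Q) * `|y|.
Proof.
move=> /andP[q0 qQ] /andP[c0 cQ] aQ xE.
have x0 := normr_ge0 x; have a0 := normr_ge0 alpha.
have xle : `|x| <= `|alpha| * Q * `|x| + `|alpha| * `|y|.
  rewrite {1}xE; apply: le_trans (ler_normB _ _) _.
  rewrite !normrM (ger0_norm q0) lerD2r mulrA.
  by rewrite ler_wpM2r// ler_wpM2l.
rewrite normrM (ger0_norm c0) mulrAC ler_pdivlMr ?subr_gt0//.
have {}xle : `|x| * (1 - `|alpha| * Q) <= `|alpha| * `|y| by lra.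
apply: (@le_trans _ _ (Q * (`|x| * (1 - `|alpha| * Q)))).
  rewrite -mulrA ler_wpM2r// mulr_ge0// subr_ge0; exact: ltW.
have -> : `|alpha| * Q * `|y| = Q * (`|alpha| * `|y|) by ring.
by rewrite ler_wpM2l// (le_trans c0).
Qed.

(** The errors at the final time contract by [r] at every iteration. The last
    iteration contracts from the final time to the initial time, by the same
    factor since [1 <= Q], and the evolution over [0, t] costs one more [Q]. *)
Lemma mode_iterates_bound (R : realType) (alpha d T Q : R) (w : nat -> R -> R) :
  0 <= T -> 1 <= Q -> expR (- (d * T)) <= Q -> `|alpha| * Q < 1 ->
  (forall k t, (1 <= k)%N -> t \in `[0, T] ->
     w k t = expR (- (d * t)) * w k 0) ->
  (forall k, w k.+1 0 = alpha * w k.+1 T - alpha * w k T) ->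
  let r := `|alpha| * Q / (1 - `|alpha| * Q) in
  forall k t, (1 <= k)%N -> t \in `[0, T] ->
    `|w k t| <= Q * r ^+ k * `|w 0%N T|.
Proof.
move=> T0 Q1 qQ aQ wE w0 r.
have Q0 : 0 <= Q by lra.
have r0 : 0 <= r by rewrite divr_ge0 ?mulr_ge0// subr_ge0 ltW.
have TT : T \in `[0, T] by rewrite in_itv/= T0 lexx.
set q := expR (- (d * T)) in qQ.
have q0 : 0 <= q by exact: expR_ge0.
have qI : 0 <= q <= Q by rewrite q0.
have w0q k : w k.+1 0 = alpha * (q * w k.+1 0) - alpha * w k T.
  by rewrite -wE//; exact: w0.
have wT k : `|w k T| <= r ^+ k * `|w 0%N T|.
  elim: k => [|k IH]; first by rewrite expr0 mul1r.
  rewrite wE// -/q exprS -mulrA.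
  apply: le_trans (shooting_step qI qI aQ (w0q k)) _.
  by rewrite -/r ler_wpM2l.
case=> [//|k] t _ tT; rewrite wE// normrM -mulrA.
have growth : `|expR (- (d * t))| <= Q.
  move: tT; rewrite in_itv/= => /andP[t0 tT]; rewrite ger0_norm ?expR_ge0//.
  have [d0|d0] := leP 0 d.
    apply: le_trans Q1; rewrite -expR0 ler_expR oppr_le0; exact: mulr_ge0.
  by apply: le_trans qQ; rewrite ler_expR lerN2 ler_wnM2l// ltW.
apply: ler_pM => //.
have cI : 0 <= (1 : R) <= Q by rewrite ler01.
have := shooting_step qI cI aQ (w0q k); rewrite mul1r -/r => /le_trans; apply.
by rewrite exprS -[leRHS]mulrA ler_wpM2l.
Qed.

(** * Diagonalization of the algorithm *)

(** Diagonalizing [A] decouples the system: the [p]-th coordinate of the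
    difference of two solutions solves $f' = - c_p f$. *)
Lemma solves_on_mode (R : realType) (n : nat) (A P : 'M[R]_n) (c : 'rV[R]_n)
    (T : R) (v w : R -> 'cV[R]_n) (p : 'I_n) :
  P \in unitmx -> A = P *m diag_mx c *m invmx P ->
  solves_on A T v -> solves_on A T w ->
  forall t, t \in `[0, T] ->
    (invmx P *m (v t - w t)) p 0
      = expR (- (c 0 p * t)) * (invmx P *m (v 0 - w 0)) p 0.
Proof.
move=> Pu AE [cv dv _] [cw dw _].
apply: (@linear_ode_unique _ _ _ (fun t => (invmx P *m (v t - w t)) p 0)).
  apply: within_continuous_mulmx_coord => x.
  by apply: continuousB; [exact: cv | exact: cw].
move=> t tT; have dvt := dv t tT; have dwt := dw t tT.
have dvw : is_derive t (1 : R) (fun s => v s - w s) (- (A *m (v t - w t))).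
  apply: (is_derive_eq (is_deriveB dvt dwt)).
  by rewrite mulmxBr opprB opprK addrC.
apply: (is_derive_eq (is_derive_mulmx_coord (invmx P) p dvw)).
by rewrite mulmxN mxE AE -!mulmxA mulKmx// mul_diag_mx mxE.
Qed.

(** * The growth exponent *)

(** [g] at $z = \lambda T$ is the decay exponent of the mode over [0, T]. *)
Lemma gE (R : realType) (T beta eps l : R) : T != 0 ->
  g T beta eps (l * T) = (beta ^+ 2 * l + eps ^+ 2 * l ^+ 2) * T.
Proof. by move=> T0; rewrite /g; field. Qed.

(** Completing the square. *)
Lemma g_zstar_le (R : realType) (T beta eps z : R) : 0 < T -> 0 < eps ->
  g T beta eps (zstar T beta eps) <= g T beta eps z.
Proof.
move=> T0 e0; rewrite -subr_ge0.
have -> : g T beta eps z - g T beta eps (zstar T beta eps)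
    = eps ^+ 2 / T * (z - zstar T beta eps) ^+ 2.
  by rewrite /g /zstar; field; rewrite !gt_eqF.
by rewrite mulr_ge0 ?sqr_ge0// divr_ge0 ?sqr_ge0// ltW.
Qed.

Lemma g_ge0_left_of_zcrit (R : realType) (T beta eps z : R) :
  0 < T -> 0 < eps -> z <= zcrit T beta eps -> 0 <= g T beta eps z.
Proof.
move=> T0 e0 zc.
have -> : g T beta eps z = eps ^+ 2 / T * ((- z) * (zcrit T beta eps - z)).
  by rewrite /g /zcrit; field; rewrite !gt_eqF.
have zc0 : zcrit T beta eps <= 0.
  by rewrite oppr_le0 divr_ge0 ?sqr_ge0// mulr_ge0 ?sqr_ge0// ltW.
apply: mulr_ge0; first by rewrite divr_ge0 ?sqr_ge0// ltW.
by rewrite mulr_ge0 ?subr_ge0// oppr_ge0 (le_trans zc).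
Qed.

Theorem theorem3p2 (R : realType) (Nx : nat) (h beta eps T alpha : R)
    (P : 'M[R]_Nx) (u0 : 'cV[R]_Nx)
    (u : R -> 'cV[R]_Nx) (uk : nat -> R -> 'cV[R]_Nx)
    (hNx : (2 <= Nx)%N) (hh : 0 < h)
    (hbeta : - (1 / Num.sqrt 3) <= beta <= 1 / Num.sqrt 3)
    (heps : 0 < eps < 1) (hT : 0 < T) (halpha : `|alpha| < 1 / 2)
    (hPunit : P \in unitmx)
    (hPeig : forall p : 'I_Nx, laplacian Nx h *m col p P = lambda h p *: col p P)
    (hPD : opA Nx h beta eps = P *m opD Nx h beta eps *m invmx P)
    (hu : solves_on (opA Nx h beta eps) T u) (hu0 : u 0 = u0)
    (hguess : {within `[0, T], continuous (uk 0%N)})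
    (huk : pint_iterates (opA Nx h beta eps) T alpha u0 uk) :
  let e (k : nat) (t : R) : 'cV[R]_Nx := uk k t - u t in
  let E : R := expR (- g T beta eps (zstar T beta eps)) in
  let J1 : pred 'I_Nx := fun p => lambda h p * T > zcrit T beta eps in
  let J2 : pred 'I_Nx := fun p => lambda h p * T <= zcrit T beta eps in
  forall k : nat, (1 <= k)%N ->
    (`|alpha| * E < 1 ->
     normLinf T (fun t => restr J1 (invmx P *m e k t))
       <= E * (`|alpha| * E / (1 - `|alpha| * E)) ^+ k
          * normLinf T (fun t => restr J1 (invmx P *m e 0%N t)))
    /\
    normLinf T (fun t => restr J2 (invmx P *m e k t))
      <= (`|alpha| / (1 - `|alpha|)) ^+ k
         * normLinf T (fun t => restr J2 (invmx P *m e 0%N t)).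
Proof.
move=> e E J1 J2.
have /andP[eps0 _] := heps.
have T0 := ltW hT.
have TT : T \in `[0, T] by rewrite in_itv/= T0 lexx.
pose d (p : 'I_Nx) : R := beta ^+ 2 * lambda h p + eps ^+ 2 * lambda h p ^+ 2.
pose w (p : 'I_Nx) (k : nat) (t : R) : R := (invmx P *m e k t) p 0.
have wE (p : 'I_Nx) (k : nat) (t : R) : (1 <= k)%N -> t \in `[0, T] ->
    w p k t = expR (- (d p * t)) * w p k 0.
  move=> k1 tT; have [sk _] := huk k k1.
  by rewrite /w /e (solves_on_mode p hPunit hPD sk hu tT) mxE.
have w0 (p : 'I_Nx) (k : nat) :
    w p k.+1 0 = alpha * w p k.+1 T - alpha * w p k T.
  have [_ uk0] := huk k.+1 isT.
  have e0 : e k.+1 0 = alpha *: (e k.+1 T - e k T).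
    by rewrite /e uk0 hu0 addrK opprB addrA subrK scalerBr.
  by rewrite /w e0 -scalemxAr mulmxBr !mxE mulrBr.
have w0_continuous p : {within `[0, T], continuous (w p 0%N)}.
  apply: within_continuous_mulmx_coord => x.
  by apply: continuousB; [exact: hguess | case: hu => cu _ _; exact: cu].
(* The two estimates are the cases Q = E and Q = 1. *)
have main (Q : R) (J : pred 'I_Nx) : 1 <= Q -> `|alpha| * Q < 1 ->
    (forall p, J p -> expR (- (d p * T)) <= Q) ->
    forall k, (1 <= k)%N ->
    normLinf T (fun t => restr J (invmx P *m e k t))
      <= Q * (`|alpha| * Q / (1 - `|alpha| * Q)) ^+ k
         * normLinf T (fun t => restr J (invmx P *m e 0%N t)).
  move=> Q1 aQ JQ k k1.
  have restrE (i : nat) (s : R) (p : 'I_Nx) :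
      restr J (invmx P *m e i s) p 0 = if J p then w p i s else 0.
    by rewrite mxE.
  have r0 : 0 <= Q * (`|alpha| * Q / (1 - `|alpha| * Q)) ^+ k.
    have Q0 : 0 <= Q by lra.
    by rewrite mulr_ge0// exprn_ge0// divr_ge0 ?mulr_ge0// subr_ge0 ltW.
  have cJ p : {within `[0, T],
      continuous (fun t => restr J (invmx P *m e 0%N t) p 0)}.
    rewrite (eq_fun (restrE 0%N ^~ p)).
    by case: (J p) => //; apply: continuous_subspaceT => x; exact: cvg_cst.
  (* the recursion ends with the value of the initial error at T *)
  have leN p := coord_le_normLinf T0 cJ p TT.
  have N0 : 0 <= normLinf T (fun t => restr J (invmx P *m e 0%N t)).
    by apply: le_trans (leN (Ordinal hNx)); exact: normr_ge0.
  apply: normLinf_le => //; first exact: mulr_ge0.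
  move=> t p tT; rewrite restrE; case: ifPn => Jp; last first.
    by rewrite normr0 mulr_ge0.
  have := mode_iterates_bound T0 Q1 (JQ p Jp) aQ (wE p) (w0 p) k1 tT.
  move=> /le_trans; apply; rewrite ler_wpM2l//.
  by have := leN p; rewrite restrE Jp.
have dT p : d p * T = g T beta eps (lambda h p * T) by rewrite gE// gt_eqF.
move=> k k1; split=> [aE|].
  apply: main => // [|p _].
    (* E is at least 1 because g vanishes at 0 *)
    rewrite /E -expR0 ler_expR oppr_ge0.
    have := g_zstar_le beta 0 hT eps0.
    by rewrite [leRHS]/g expr0n/= !mulr0 addr0.
  by rewrite dT ler_expR lerN2 g_zstar_le.
have -> : (`|alpha| / (1 - `|alpha|)) ^+ k
    = 1 * (`|alpha| * 1 / (1 - `|alpha| * 1)) ^+ k by rewrite !mulr1 mul1r.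
apply: main => //; first by rewrite mulr1; lra.
by move=> p Jp; rewrite dT -expR0 ler_expR oppr_le0 g_ge0_left_of_zcrit.
Qed.
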